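(* Let $x,y\in\mathbb{R}$. The element $xI+yE\in LC_2$ is invertible if and only if $x^2-y^2\neq 0$.
   Context: $\mathbb{P}_2$ is the real vector space of all functions $f:\mathbb{R}\to\mathbb{R}$ with $f(t+2)=f(t)$ for all $t$. $I$ is the identity operator and $E$ the unit shift $(Ef)(t)=f(t+1)$ on $\mathbb{P}_2$, so $E^2=I$. $LC_2=\{xI+yE: x,y\in\mathbb{R}\}$, with multiplication $(x_1I+y_1E)(x_2I+y_2E)=(x_1x_2+y_1y_2)I+(x_1y_2+x_2y_1)E$. An element $L\in LC_2$ is called invertible if there exists $M=aI+bE\in LC_2$ with $LM=I$. *)

(* Defs.v *)
From HB Require Import structures.
From mathcomp Require Import all_boot all_order all_algebra.
From mathcomp Require Import all_classical all_reals.
From mathcomp Require Import normedtype trigo.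

Set Implicit Arguments.
Unset Strict Implicit.
Unset Printing Implicit Defensive.

Import Order.TTheory GRing.Theory Num.Theory.
Import numFieldNormedType.Exports.

Local Open Scope classical_set_scope.
Local Open Scope ring_scope.

Section P2.
Variable R : realType.

Definition periodic2 : {pred (R -> R)} := [pred f | `[< periodic f 2 >]].

Record P2 := MkP2 { P2_val :> R -> R; P2_valP : P2_val \in periodic2 }.

HB.instance Definition _ := [isSub for P2_val].
HB.instance Definition _ := [Choice of P2 by <:].

Lemma periodic2P (f : R -> R) : (f \in periodic2) <-> forall t, f (t + 2) = f t.
Proof. by split=> [/asboolP|] // ?; apply/asboolP. Qed.

Lemma periodic2_submod_closed : submod_closed periodic2.
Proof.
split=> [|a f g /periodic2P fP /periodic2P gP]; apply/periodic2P => t //.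
by rewrite !fctE fP gP.
Qed.

HB.instance Definition _ :=
  GRing.isSubmodClosed.Build R (R -> R) periodic2 periodic2_submod_closed.
HB.instance Definition _ := [SubChoice_isSubLmodule of P2 by <:].

Lemma shift_periodic2 (f : P2) : (fun t => f (t + 1)) \in periodic2.
Proof.
by apply/periodic2P => t; rewrite addrAC; move/periodic2P: (P2_valP f) => ->.
Qed.

Definition E (f : P2) : P2 := MkP2 (shift_periodic2 f).

Lemma EE : E \o E = id.
Proof.
apply/funext => f; apply/val_inj/funext => t /=.
by rewrite -addrA; move/periodic2P: (P2_valP f) => ->.
Qed.

Fact E_is_linear : linear E.
Proof. by move=> a f g; apply/val_inj. Qed.

HB.instance Definition _ := GRing.isLinear.Build R P2 P2 *:%R E E_is_linear.

(* The operator x I + y E; sums and scalar multiples of operators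
   P2 -> P2 are taken pointwise. *)
Definition lc2 (x y : R) : P2 -> P2 := x *: id + y *: E.

Definition LC2 : set (P2 -> P2) := [set L | exists x y, L = lc2 x y].

(* The product of operators is their composition; on LC2 it is given by the
   following formula. *)
Lemma lc2_comp x1 y1 x2 y2 :
  lc2 x1 y1 \o lc2 x2 y2 = lc2 (x1 * x2 + y1 * y2) (x1 * y2 + x2 * y1).
Proof.
have EEf g : E (E g) = g by rewrite -[RHS]/(id g) -EE.
apply/funext => f; rewrite /lc2 !fctE !(linearD, linearZ) /= EEf.
rewrite !scalerA !scalerDl.
rewrite (mulrC x2) (mulrC y2 x1) (mulrC y2 y1).
by rewrite [X in _ + X = _]addrC addrACA.
Qed.

Definition LC2_invertible (L : P2 -> P2) : Prop :=
  LC2 L /\ exists2 M, LC2 M & L \o M = id.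

End P2.

(* Main.v *)
Require Import Defs.
From mathcomp Require Import all_boot all_order all_algebra.
From mathcomp Require Import all_classical all_reals.
From mathcomp Require Import trigo.

Import GRing.Theory.

Local Open Scope ring_scope.

(** As [E] squares to the identity, its possible eigenvalues are [1] and [-1],
    and both occur: on the constant function [1] and on [t |-> cos (pi t)].  On
    these two functions [x I + y E] acts as multiplication by [x + y] and
    [x - y], so it can be invertible only if neither factor of
    [x^2 - y^2 = (x + y)(x - y)] vanishes ([lc2_eigenvalue_neq0]).  Conversely
    [(x I + y E)(x I - y E) = (x^2 - y^2) I], so dividing the conjugate
    [x I - y E] by [x^2 - y^2] gives an inverse. *)

Lemma lc2_eigenvector (R : realType) (x y e : R) (f : P2 R) :
  E f = e *: f -> lc2 x y f = (x + y * e) *: f.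
Proof. by move=> Ef; rewrite /lc2 !fctE Ef scalerA -scalerDl. Qed.

Lemma cst1_periodic2 (R : realType) : (fun=> 1 : R) \in @periodic2 R.
Proof. exact/periodic2P. Qed.

Definition P2_one (R : realType) : P2 R := MkP2 (cst1_periodic2 R).

Lemma cospi_periodic2 (R : realType) :
  (fun t : R => cos (pi * t)) \in @periodic2 R.
Proof.
apply/periodic2P => t.
by rewrite -[2]/(1 + 1) addrA !mulrDr mulr1 !cosDpi opprK.
Qed.

Definition P2_cospi (R : realType) : P2 R := MkP2 (cospi_periodic2 R).

Lemma E_one (R : realType) : E (P2_one R) = 1 *: P2_one R.
Proof. by rewrite scale1r; apply/val_inj. Qed.

Lemma E_cospi (R : realType) : E (P2_cospi R) = (-1) *: P2_cospi R.
Proof.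
rewrite scaleN1r; apply/val_inj/funext => t /=.
by rewrite mulrDr mulr1 cosDpi.
Qed.

Lemma P2_one_neq0 (R : realType) : P2_one R != 0.
Proof.
apply/eqP => /(congr1 (fun f : P2 R => f 0)) /eqP.
by rewrite /= oner_eq0.
Qed.

Lemma P2_cospi_neq0 (R : realType) : P2_cospi R != 0.
Proof.
apply/eqP => /(congr1 (fun f : P2 R => f 0)) /eqP.
by rewrite /= mulr0 cos0 oner_eq0.
Qed.

(** A right inverse [M] in [LC2] has the same eigenvector [f], so
    [f = L (M f)] is a multiple of [(x + y e) f]. *)
Lemma lc2_eigenvalue_neq0 (R : realType) (x y e : R) (f : P2 R) :
  E f = e *: f -> f != 0 -> LC2_invertible (lc2 x y) -> x + y * e != 0.
Proof.
move=> Ef f_neq0 [_ [_ [a [b ->]] /(congr1 (fun L => L f)) /= LMf]].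
apply: contra_neq f_neq0 => xye0.
rewrite -[LHS]LMf (lc2_eigenvector _ a b _ _ Ef).
have Ecf c : E (c *: f) = e *: (c *: f).
  by rewrite linearZ /= Ef !scalerA mulrC.
by rewrite (lc2_eigenvector _ x y _ _ (Ecf _)) xye0 scale0r.
Qed.

Theorem theorem2p9 (R : realType) (x y : R) :
  LC2_invertible (lc2 x y) <-> x ^+ 2 - y ^+ 2 != 0.
Proof.
split=> [inv_xy | d_neq0].
  rewrite subr_sqr mulf_neq0 //.
    have := lc2_eigenvalue_neq0 _ _ _ _ _ (E_cospi R) (P2_cospi_neq0 R) inv_xy.
    by rewrite mulrN1.
  have := lc2_eigenvalue_neq0 _ _ _ _ _ (E_one R) (P2_one_neq0 R) inv_xy.
  by rewrite mulr1.
split; first by exists x, y.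
set d := x ^+ 2 - y ^+ 2 in d_neq0.
exists (lc2 (x / d) (- y / d)); first by exists (x / d), (- y / d).
rewrite lc2_comp.
have -> : x * (x / d) + y * (- y / d) = 1.
  by rewrite !mulrA -mulrDl mulrN -!expr2 divff.
have -> : x * (- y / d) + x / d * y = 0.
  by rewrite mulrAC mulrA -mulrDl mulrN addNr mul0r.
by rewrite /lc2 scale1r scale0r addr0.
Qed.
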